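(* Let $b \ge 2$ be an integer. If a positive integer $n$ is not a comma-child in base $b$ of any positive integer, then $1 \le n \le b^2-1$.
   Context: Fix a base $b \ge 2$. For a positive integer $n$, let $\delta(n)$ denote its leading (most significant, nonzero) base-$b$ digit. For positive integers $k, k'$, we say that $k'$ is a comma-child of $k$ (in base $b$) if $k' - k = d\cdot b + \delta(k')$, where $d = k \bmod b$ is the last base-$b$ digit of $k$. *)

(* Defs.v *)
(* Library: MathComp. *)
From mathcomp Require Import all_boot all_order all_algebra.
Set Implicit Arguments.
Unset Strict Implicit.
Unset Printing Implicit Defensive.

(* For b >= 2 and n > 0, [trunc_log b n] is the exponent e with
   b ^ e <= n < b ^ e.+1, i.e. the position of the leading digit. *)
Definition leading_digit (b n : nat) : nat := n %/ b ^ trunc_log b n.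

(* The difference is taken in int, as subtraction on nat is truncated.
   The predicate is meant for positive k and k'; positivity is left to
   its users. *)
Definition comma_child (b k k' : nat) : Prop :=
  (k'%:Z - k%:Z = ((k %% b) * b + leading_digit b k')%N%:Z)%R.

(* Main.v *)
(* For n >= b^2 with leading digit a, set m = n - a and d = m %% b.  The number
   k = m - d * b again ends in d, so k + d * b + a = n; it is positive because
   a < b forces m %/ b >= b - 1 >= d. *)
Require Import Defs.
From mathcomp Require Import all_boot all_order all_algebra.
From mathcomp Require Import zify.

(** By contraposition, via [comma_child_exists]. A parent k of n satisfies k = n - a modulo b, so
    its last digit d is forced and n - a - d * b is the only candidate; n >= b ^ 2 makes it
    positive. *)

Lemma ltn_leading_digit (b n : nat) : 1 < b -> leading_digit b n < b.
Proof.
move=> b_gt1; rewrite /leading_digit ltn_divLR ?expn_gt0 ?(ltnW b_gt1) //.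
by rewrite -expnS trunc_log_ltn.
Qed.

Lemma comma_child_exists (b n : nat) :
  1 < b -> b ^ 2 <= n -> exists k : nat, 0 < k /\ comma_child b k n.
Proof.
move=> b_gt1 b2_le_n; have a_lt_b := ltn_leading_digit b n b_gt1.
rewrite /comma_child; set a := leading_digit b n in a_lt_b *.
have d_lt_b : (n - a) %% b < b by rewrite ltn_mod ltnW.
have m_eq := divn_eq (n - a) b.
(* Since a <= b - 1, n - a >= b ^ 2 - b + 1 > (b - 1) * b. *)
have q_ge : b.-1 <= (n - a) %/ b by rewrite leq_divRL 1?ltnW //; nia.
set d := _ %% b in d_lt_b m_eq; set q := _ %/ b in q_ge m_eq.
exists ((q - d) * b + d); rewrite modnMDl (modn_small d_lt_b).
(* As d <= b - 1 <= q, [q - d] is not truncated. Positivity: if d = 0 the witness is q * b with q >=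
   b - 1 > 0; otherwise it is at least d. *)
by split; nia.
Qed.

Theorem theorem5p5 (b : nat) (hb : 2 <= b) (n : nat) (hn : 0 < n)
  (hchild : ~ exists k : nat, 0 < k /\ comma_child b k n) :
  1 <= n <= b ^ 2 - 1.
Proof.
rewrite hn /=; case: (leqP (b ^ 2) n) => [b2_le_n|]; last by lia.
by case: hchild; apply: comma_child_exists.
Qed.
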